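(* Let the system $(A,B,C)$ (with $D=0$) be externally symmetric with signature matrix $\Sigma_e$, let $Q\succeq0$, $R\succ0$, $Q_x=C'QC$, assume that $(A,B)$ is stabilizable and $(A,\sqrt{Q_x})$ is detectable, and assume $\Vert Q\Vert_\infty\Vert G\Vert_{\rm pk}^2\Vert R^{-1}\Vert_\infty<1$. Let $\alpha\in(0,1]$, $x_0\in\mathbb{R}^n$ and $e>0$. For $t_f\in(0,\infty)$ let $\eta_{1,k},\eta_{2,k}$ ($k=0,1,2,\dots$) be pairwise independent $\mathbb{R}^m$-valued stochastic processes on $[0,t_f]$, each of which satisfies $\mathbb{E}(\eta(t))=0$ for $t\in[0,t_f]$ and, almost surely, $\Vert\eta(t)\Vert_\infty\le e$ for all $t\in[0,t_f]$. Let $u_0\in\mathcal{L}_\infty^m(0,t_f)$ be deterministic, let $(u_k)$ be the nominal iterates $u_{k+1}=(1-\alpha)u_k+\alpha\mathcal{T}(u_k)$, let $(\tilde u_k)$ be the noisy iterates with $\tilde u_0=u_0$, $\tilde u_{k+1}=(1-\alpha)\tilde u_k+\alpha\tilde{\mathcal{T}}_k(\tilde u_k)$, and put $\nu_k=\tilde u_k-u_k$. Then $\mathbb{E}(\nu_k)=0$ for all $k\in\mathbb{N}$ (i.e. $\mathbb{E}(\nu_k(t))=0$ for almost every $t\in[0,t_f]$), and $\nu_k$ has bounded variance as $t_f\to\infty$: there is a finite constant $c$, independent of $t_f$ and $k$, such that $\Vert\mathrm{Cov}(\nu_k;t)\Vert_\infty\le c$ for all $k\in\mathbb{N}$, all $t_f\in(0,\infty)$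 and almost every $t\in[0,t_f]$.
   Context: A prime denotes transpose. The system is $\frac{d}{dt}x=Ax+Bu$, $y=Cx$ with $x(t)\in\mathbb{R}^n$, $u(t),y(t)\in\mathbb{R}^m$, real matrices $A,B,C$, transfer function $G(s)=C(sI-A)^{-1}B$. A signature matrix is a diagonal matrix with diagonal entries in $\{-1,+1\}$; the system is externally symmetric with signature matrix $\Sigma_e$ if $\Sigma_eG(s)'=G(s)\Sigma_e$. $Q,R\in\mathbb{R}^{m\times m}$ are symmetric. $\mathcal{L}_\infty^m(0,t_f)$ is the space of (classes of a.e. equal) measurable essentially bounded $u:[0,t_f]\to\mathbb{R}^m$. For matrices $\Vert\cdot\Vert_\infty$ is the maximum absolute row sum. The peak-to-peak gain is $\Vert G\Vert_{\rm pk}=\Vert\int_0^\infty|C\exp(At)B|\,dt\Vert_\infty$ (entrywise absolute value), required to be finite. Define $\mathcal{J}u(t)=u(t_f-t)$, $\mathcal{G}u(t)=\int_0^tC\exp(A(t-\tau))Bu(\tau)d\tau$, $d_{x_0}(t)=C\exp(At)x_0$ for $t\in[0,t_f]$, matrices acting pointwise on signals, and $$\mathcal{T}(u)=-R^{-1}\Sigma_e\mathcal{J}\mathcal{G}\Sigma_eQ\mathcal{J}(\mathcal{G}u+d_{x_0}),$$ $$\tilde{\mathcal{T}}_k(u)=-R^{-1}\Sigma_e\mathcal{J}\bigl(\mathcal{G}\,\Sigma_eQ\mathcal{J}(\mathcal{G}u+d_{x_0}+\eta_{1,k})+\eta_{2,k}\bigr).$$ $\mathrm{Cov}(x;t)$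 is the covariance matrix of the random vector $x(t)$. Stochastic processes are jointly measurable. *)

(* Defs.v *)
From HB Require Import structures.
From mathcomp Require Import all_boot all_order all_algebra.
From mathcomp Require Import all_classical all_reals all_analysis.
From mathcomp Require Import complex.

Set Implicit Arguments.
Unset Strict Implicit.
Unset Printing Implicit Defensive.

Import Order.TTheory GRing.Theory Num.Theory.
Import numFieldNormedType.Exports.

Local Open Scope classical_set_scope.
Local Open Scope ring_scope.
Local Open Scope complex_scope.

Definition expmx (R : realType) (n : nat) (A : 'M[R]_n) : 'M[R]_n :=
  lim (series (fun k : nat => (k`!%:R)^-1 *: (A ^+ k : 'M[R]_n)) @ \oo).

(** Maximum absolute row sum.  Entries are extended reals because it is also
    applied to matrices of integrals and of covariances. *)
Definition norm_oo (R : realType) (m n : nat) (M : 'M[\bar R]_(m, n)) : \bar R :=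
  (\big[maxe/0]_(i < m) \sum_(j < n) `|M i j|)%E.

Definition is_psd (R : realType) (n : nat) (M : 'M[R]_n) : Prop :=
  M^T = M /\ forall x : 'cV[R]_n, 0 <= (x^T *m M *m x) 0 0.

Definition is_pd (R : realType) (n : nat) (M : 'M[R]_n) : Prop :=
  M^T = M /\ forall x : 'cV[R]_n, x != 0 -> 0 < (x^T *m M *m x) 0 0.

(** The positive semidefinite square root, which exists and is unique when [M]
    is positive semidefinite (the default value 0 is then not used). *)
Definition sqrtmx (R : realType) (n : nat) (M : 'M[R]_n) : 'M[R]_n :=
  xget 0 [set S : 'M[R]_n | is_psd S /\ S *m S = M].

Definition is_signature (R : realType) (m : nat) (S : 'M[R]_m) : Prop :=
  is_diag_mx S /\ forall i, S i i = 1 \/ S i i = -1.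

Definition mxC (R : realType) (m n : nat) (M : 'M[R]_(m, n)) : 'M[R[i]]_(m, n) :=
  map_mx (fun x : R => x%:C) M.

Definition is_hurwitz (R : realType) (n : nat) (A : 'M[R]_n) : Prop :=
  forall l : R[i], eigenvalue (mxC A) l -> complex.Re l < 0.

Definition stabilizable (R : realType) (n m : nat)
    (A : 'M[R]_n) (B : 'M[R]_(n, m)) : Prop :=
  exists K : 'M[R]_(m, n), is_hurwitz (A + B *m K).

Definition detectable (R : realType) (n p : nat)
    (A : 'M[R]_n) (C : 'M[R]_(p, n)) : Prop :=
  exists L : 'M[R]_(n, p), is_hurwitz (A + L *m C).

Definition transfer_function (R : realType) (n m : nat)
    (A : 'M[R]_n) (B : 'M[R]_(n, m)) (C : 'M[R]_(m, n)) (s : R[i]) :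
    'M[R[i]]_m :=
  mxC C *m invmx (s%:M - mxC A) *m mxC B.

(** [transfer_function] is meaningful only off the spectrum of [A], where
    [invmx] is the inverse. *)
Definition externally_symmetric (R : realType) (n m : nat)
    (A : 'M[R]_n) (B : 'M[R]_(n, m)) (C : 'M[R]_(m, n)) (Se : 'M[R]_m) : Prop :=
  is_signature Se /\
  forall s : R[i], ~~ eigenvalue (mxC A) s ->
    mxC Se *m (transfer_function A B C s)^T
    = transfer_function A B C s *m mxC Se.

Definition peak_gain (R : realType) (n m : nat)
    (A : 'M[R]_n) (B : 'M[R]_(n, m)) (C : 'M[R]_(m, n)) : \bar R :=
  norm_oo (\matrix_(i, j)
    (\int[lebesgue_measure]_(t in `[0%R, +oo[)
       (`|(C *m expmx (t *: A) *m B) i j|%R)%:E)%E).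

(** A signal on [0, tf] is represented by a function on the whole line; only
    its values on [0, tf] matter below. *)
Definition signal (R : realType) (m : nat) : Type := R -> 'cV[R]_m.

(** The norm [`|v|] of a column vector is its maximum absolute entry. *)
Definition is_Linfty (R : realType) (m : nat) (tf : R) (u : signal R m) : Prop :=
  (forall i, measurable_fun `[0, tf] (fun t => u t i 0)) /\
  exists M : R, {ae lebesgue_measure, forall t, t \in `[0, tf] -> `|u t| <= M}.

Definition mxact (R : realType) (m p : nat) (M : 'M[R]_(p, m))
    (u : signal R m) : signal R p :=
  fun t => M *m u t.

Definition time_reversal (R : realType) (m : nat) (tf : R)
    (u : signal R m) : signal R m :=
  fun t => u (tf - t).

Definition io_map (R : realType) (n m : nat)
    (A : 'M[R]_n) (B : 'M[R]_(n, m)) (C : 'M[R]_(m, n))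
    (u : signal R m) : signal R m :=
  fun t => \col_i
    \int[lebesgue_measure]_(tau in `[0, t])
      (C *m expmx ((t - tau) *: A) *m B *m u tau) i 0.

Definition free_response (R : realType) (n m : nat)
    (A : 'M[R]_n) (C : 'M[R]_(m, n)) (x0 : 'cV[R]_n) : signal R m :=
  fun t => C *m expmx (t *: A) *m x0.

(** [W] is the input weight usually written R, a name taken here by the reals. *)
Definition Top (R : realType) (n m : nat)
    (A : 'M[R]_n) (B : 'M[R]_(n, m)) (C : 'M[R]_(m, n)) (Se Q W : 'M[R]_m)
    (x0 : 'cV[R]_n) (tf : R) (u : signal R m) : signal R m :=
  let G := io_map A B C in
  let J := @time_reversal R m tf in
  mxact (- invmx W *m Se)
    (J (G (mxact (Se *m Q) (J (G u \+ free_response A C x0))))).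

Definition noisy_Top (R : realType) (n m : nat)
    (A : 'M[R]_n) (B : 'M[R]_(n, m)) (C : 'M[R]_(m, n)) (Se Q W : 'M[R]_m)
    (x0 : 'cV[R]_n) (tf : R) (e1 e2 : signal R m) (u : signal R m) :
    signal R m :=
  let G := io_map A B C in
  let J := @time_reversal R m tf in
  mxact (- invmx W *m Se)
    (J (G (mxact (Se *m Q) (J (G u \+ free_response A C x0 \+ e1))) \+ e2)).

(** The recursion produces an everywhere-defined representative of each iterate;
    on [0, tf] changing [u0] on a null set changes it only on a null set. *)
Fixpoint nominal_iter (R : realType) (n m : nat)
    (A : 'M[R]_n) (B : 'M[R]_(n, m)) (C : 'M[R]_(m, n)) (Se Q W : 'M[R]_m)
    (x0 : 'cV[R]_n) (tf alpha : R) (u0 : signal R m) (k : nat) : signal R m :=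
  if k is k'.+1 then
    let u := nominal_iter A B C Se Q W x0 tf alpha u0 k' in
    fun t => (1 - alpha) *: u t + alpha *: Top A B C Se Q W x0 tf u t
  else u0.

(** [eta1] and [eta2] are sample paths of the two noise sequences: the noisy
    iteration is run path by path. *)
Fixpoint noisy_iter (R : realType) (n m : nat)
    (A : 'M[R]_n) (B : 'M[R]_(n, m)) (C : 'M[R]_(m, n)) (Se Q W : 'M[R]_m)
    (x0 : 'cV[R]_n) (tf alpha : R) (u0 : signal R m)
    (eta1 eta2 : nat -> signal R m) (k : nat) : signal R m :=
  if k is k'.+1 then
    let u := noisy_iter A B C Se Q W x0 tf alpha u0 eta1 eta2 k' in
    fun t => (1 - alpha) *: u t
      + alpha *: noisy_Top A B C Se Q W x0 tf (eta1 k') (eta2 k') u t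
  else u0.

Definition process (R : realType) (m : nat) (Omega : Type) : Type :=
  R -> Omega -> 'cV[R]_m.

Definition sample_path (R : realType) (m : nat) (Omega : Type)
    (X : process R m Omega) (w : Omega) : signal R m :=
  fun t => X t w.

Definition jointly_measurable (R : realType) (m : nat) (d : measure_display)
    (Omega : measurableType d) (tf : R) (X : process R m Omega) : Prop :=
  forall i, measurable_fun (`[0, tf] `*` [set: Omega])
    (fun p : R * Omega => X p.1 p.2 i 0).

Definition process_sigma_algebra (R : realType) (m : nat) (d : measure_display)
    (Omega : measurableType d) (tf : R) (X : process R m Omega) :
    set (set Omega) :=
  <<s [set E | exists t i (S : set R),
        [/\ t \in `[0, tf], measurable S & E = [set w | S (X t w i 0)]] ] >>.

Definition independent_processes (R : realType) (m : nat) (d : measure_display)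
    (Omega : measurableType d) (P : probability Omega R) (tf : R)
    (X Y : process R m Omega) : Prop :=
  forall E F : set Omega,
    process_sigma_algebra tf X E -> process_sigma_algebra tf Y F ->
    P (E `&` F) = (P E * P F)%E.

Definition pairwise_independent (R : realType) (m : nat) (d : measure_display)
    (Omega : measurableType d) (P : probability Omega R) (tf : R)
    (I : Type) (X : I -> process R m Omega) : Prop :=
  forall i j : I, i <> j -> independent_processes P tf (X i) (X j).

(** Integrability is part of the definition because ['E_P[_]] is a total
    function, also defined on non-measurable or non-integrable arguments. *)
Definition mean_zero (R : realType) (m : nat) (d : measure_display)
    (Omega : measurableType d) (P : probability Omega R)
    (X : Omega -> 'cV[R]_m) : Prop :=
  forall i, P.-integrable [set: Omega] (EFin \o (fun w => X w i 0)) /\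
            ('E_P[fun w => X w i ord0] = 0)%E.

Definition Cov (R : realType) (m : nat) (d : measure_display)
    (Omega : measurableType d) (P : probability Omega R)
    (X : Omega -> 'cV[R]_m) : 'M[\bar R]_m :=
  \matrix_(i, j) covariance P (fun w => X w i 0) (fun w => X w j 0).

Definition admissible_noise (R : realType) (m : nat) (d : measure_display)
    (Omega : measurableType d) (P : probability Omega R) (tf e : R)
    (X : process R m Omega) : Prop :=
  [/\ jointly_measurable tf X,
      forall t, t \in `[0, tf] -> mean_zero P (X t)
    & {ae P, forall w, forall t, t \in `[0, tf] -> `|X t w| <= e}].

(* Main.v *)
Require Import Defs.
From HB Require Import structures.
From mathcomp Require Import all_boot all_order all_algebra.
From mathcomp Require Import all_classical all_reals all_analysis.
From mathcomp Require Import complex.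
From mathcomp Require Import measurable_realfun ring lra.

Set Implicit Arguments.
Unset Strict Implicit.
Unset Printing Implicit Defensive.

Import Order.TTheory GRing.Theory Num.Theory.
Import numFieldNormedType.Exports.

Local Open Scope classical_set_scope.
Local Open Scope ring_scope.

(** The iteration is affine in the pair (input, noise).  Run path by path, the
    deviation [nu_k] of the noisy iterate from the nominal one therefore obeys
    the same recursion with zero initial state, zero initial input and the
    noise as its only excitation ([noisy_iter_superposition]).

    Boundedness is then a small-gain estimate.  Convolution with the impulse
    response multiplies the supremum of a signal by at most the peak-to-peak
    gain [g], whatever the horizon ([convolution_norm_le]); a signature matrix
    does not increase the maximum norm, and [Q] and the inverse of [W] multiply
    it by at most their row-sum norms [q] and [r].  Hence a deviation bounded by
    [b] becomes, after one relaxed step, one bounded by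
    [(1 - alpha) * b + alpha * (r * (g * (q * (g * b + e)) + e))].  As
    [q * g ^ 2 * r < 1], the number [b = r (g q e + e) / (1 - q g ^ 2 r)] is a
    fixed point of this map, so every [nu_k] stays below it almost surely
    ([admissible_noise_driven_iter]).  Each covariance is then at most [b ^ 2]
    and each row sum at most [m b ^ 2], a bound free of [tf] and [k].

    The mean vanishes because every operation in the recursion is linear: the
    only one that is not pointwise in time is convolution, through which the
    expectation passes by Fubini's theorem ([mean_zero_convolution]).

    Both facts are carried together by the predicate [admissible_noise], which
    is stable under all the operations of the recursion.  One point of measure
    theory needs care.  On the null set of outcomes where the noise is not
    bounded, the path integrals may diverge and take their default value, yet
    integrability of [nu_k] asks for measurability on the whole sample space.
    Measurability is therefore proved for arbitrary jointly measurable
    processes, without any bound ([jointly_measurable_convolution]), and the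
    superposition identity is used only almost surely
    ([admissible_noise_deviation]). *)

(** * The matrix exponential is continuous along a line *)

(** Coefficients dominated by those of an exponential series give a power series
    that converges everywhere, by comparison with [exp (rho * |x|)]. *)
Lemma exp_bounded_pseries_cvg (R : realType) (f : R^nat) (D rho x : R) :
  (forall k, `|f k| <= D * (rho ^+ k / k`!%:R)) -> cvgn (pseries f x).
Proof.
move=> hf; have dom k : `|f k * x ^+ k| <= D *: exp_coeff (rho * `|x|) k.
  rewrite normrM normrX /exp_coeff /= exprMn.
  apply: le_trans (ler_wpM2r (exprn_ge0 k (normr_ge0 x)) (hf k)) _.
  by rewrite -mulrA [X in D * X]mulrAC.
apply: normed_cvg.
apply: (@series_le_cvg _ _ (fun k => D *: exp_coeff (rho * `|x|) k)).
- by move=> k; exact: normr_ge0.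
- by move=> k; exact: le_trans (normr_ge0 _) (dom k).
- exact: dom.
- exact/is_cvg_seriesZ/is_cvg_series_exp_coeff.
Qed.

(** Differentiating only multiplies the constant [D] by [rho], so the class of
    exponentially dominated series is closed under formal derivation; this is
    what makes termwise differentiation available. *)
Lemma exp_bounded_pseries_diffs (R : realType) (f : R^nat) (D rho : R) :
  (forall k, `|f k| <= D * (rho ^+ k / k`!%:R)) ->
  forall k, `|pseries_diffs f k| <= (D * rho) * (rho ^+ k / k`!%:R).
Proof.
move=> hf k; rewrite /pseries_diffs normrM ger0_norm//.
apply: le_trans (ler_wpM2l _ (hf k.+1)) _ => //.
rewrite factS natrM exprS invfM.
have k1 : k.+1%:R != 0 :> R by rewrite pnatr_eq0.
have kf : k`!%:R != 0 :> R by rewrite pnatr_eq0 -lt0n fact_gt0.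
rewrite [leLHS](_ : _ = D * rho * (rho ^+ k / k`!%:R))//.
by field; rewrite kf -natr1 addrC in k1 *.
Qed.

(** The sum is differentiable, because the series and its first two formal
    derivatives converge on the whole line. *)
Lemma exp_bounded_pseries_continuous (R : realType) (f : R^nat) (D rho : R) :
  (forall k, `|f k| <= D * (rho ^+ k / k`!%:R)) ->
  continuous (fun x => limn (pseries f x)).
Proof.
move=> hf x.
apply: differentiable_continuous; apply/derivable1_diffP.
have hf' := exp_bounded_pseries_diffs hf.
have hf'' := exp_bounded_pseries_diffs hf'.
have := @pseries_snd_diffs _ f (`|x| + 1) x (exp_bounded_pseries_cvg hf)
  (exp_bounded_pseries_cvg hf') (exp_bounded_pseries_cvg hf'').
rewrite [ltRHS]ger0_norm ?addr_ge0// ltrDl ltr01 => /(_ isT) [] //.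
Qed.

Lemma exprZ_mx (R : realType) n (A : 'M[R]_n) (t : R) k :
  (t *: A) ^+ k = t ^+ k *: A ^+ k.
Proof.
elim: k => [|k IH]; first by rewrite !expr0 scale1r.
by rewrite !exprS IH -!mulmxE -scalemxAl -scalemxAr scalerA.
Qed.

(** By induction on [k]: a column of [A] contributes at most the sum of all
    entries of [A] in absolute value, so each factor costs at most [rho]. *)
Lemma expr_mx_entry_bound (R : realType) n (A : 'M[R]_n) :
  let rho : R := \sum_i \sum_j `|A i j| in
  forall k i j, `|(A ^+ k) i j| <= rho ^+ k.
Proof.
move=> rho k.
have s0 (i : 'I_n) : 0 <= \sum_j `|A i j| by apply: sumr_ge0.
have rho0 : 0 <= rho by apply: sumr_ge0 => i _; exact: s0.
elim: k => [|k IH] i j.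
  by rewrite !expr0 mxE; case: eqP; rewrite ?normr1 ?normr0.
rewrite exprSr [rho ^+ _]exprSr -mulmxE mxE.
apply: le_trans (ler_norm_sum _ _ _) _.
apply: le_trans (_ : \sum_l rho ^+ k * `|A l j| <= _).
  by apply: ler_sum => l _; rewrite normrM ler_wpM2r.
rewrite -mulr_sumr ler_wpM2l ?exprn_ge0 ?rho0//.
apply: ler_sum => l _.
by rewrite (bigD1 j)//= lerDl; apply: sumr_ge0.
Qed.

(** There are finitely many entries, so the entrywise neighbourhoods of infinity
    can be intersected. *)
Lemma cvg_mx_entries (R : realType) m n (u : nat -> 'M[R]_(m, n))
    (l : 'M[R]_(m, n)) :
  (forall i j, u k i j @[k --> \oo] --> l i j) -> u @ \oo --> l.
Proof.
move=> hu; apply/cvg_mx_entourageP => E entE.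
have hE i j : \forall k \near \oo, (l i j, u k i j) \in E.
  have /cvg_entourageP/(_ E entE) := hu i j.
  rewrite near_map; apply: filterS => k.
  by rewrite inE.
have : \forall k \near \oo, forall ij : 'I_m * 'I_n,
    (l ij.1 ij.2, u k ij.1 ij.2) \in E.
  apply: (@filter_forall _ ('I_m * 'I_n)%type
    (fun ij k => (l ij.1 ij.2, u k ij.1 ij.2) \in E)) => -[i j]; exact: hE.
by apply: filterS => k h i j; exact: (h (i, j)).
Qed.

(** Each entry of the exponential is an ordinary power series in [t], which
    reduces its regularity to real analysis. *)
Lemma expmxE (R : realType) n (A : 'M[R]_n) t i j :
  expmx (t *: A) i j = limn (pseries (fun k => (A ^+ k) i j / k`!%:R) t).
Proof.
pose l : 'M[R]_n :=
  \matrix_(i, j) limn (pseries (fun k => (A ^+ k) i j / k`!%:R) t).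
suff : series (fun k : nat => (k`!%:R)^-1 *: ((t *: A) ^+ k : 'M[R]_n)) @ \oo
    --> l.
  by move=> /cvg_lim; rewrite /expmx => -> //; rewrite mxE.
apply: cvg_mx_entries => {}i {}j; rewrite mxE.
have cv : cvgn (pseries (fun k => (A ^+ k) i j / k`!%:R) t).
  apply: (exp_bounded_pseries_cvg (D := 1)
    (rho := \sum_i \sum_j `|A i j|)) => k.
  rewrite mul1r normrM ler_pM ?normr_ge0//; first exact: expr_mx_entry_bound.
  by rewrite ger0_norm.
set v := (fun N : nat => _).
suff -> : v = pseries (fun k => (A ^+ k) i j / k`!%:R) t by exact: cv.
apply/funext => N; rewrite /v /pseries /series /= summxE; apply: eq_bigr => k _.
by rewrite exprZ_mx !mxE; ring.
Qed.

Lemma continuous_expmx (R : realType) n (A : 'M[R]_n) i j :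
  continuous (fun t : R => expmx (t *: A) i j).
Proof.
under eq_fun do rewrite expmxE.
apply: (exp_bounded_pseries_continuous (D := 1)
  (rho := \sum_i \sum_j `|A i j|)) => k.
rewrite mul1r normrM ler_pM ?normr_ge0//; first exact: expr_mx_entry_bound.
by rewrite ger0_norm.
Qed.

(** * Almost-everywhere statements, the maximum norm and the time horizon *)

Lemma ae_imp d (T : measurableType d) (R : realType)
    (mu : {measure set T -> \bar R}) (P Q : T -> Prop) :
  (forall x, P x -> Q x) -> {ae mu, forall x, P x} -> {ae mu, forall x, Q x}.
Proof. by move=> PQ; apply: (@filterS _ _ (ae_filter_ringOfSetsType mu)). Qed.

Lemma ae_and d (T : measurableType d) (R : realType)
    (mu : {measure set T -> \bar R}) (P Q : T -> Prop) :
  {ae mu, forall x, P x} -> {ae mu, forall x, Q x} ->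
  {ae mu, forall x, P x /\ Q x}.
Proof. exact: (@filterI _ _ (ae_filter_ringOfSetsType mu)). Qed.

Lemma ler_mx_norm_entry (R : realType) m n (M : 'M[R]_(m, n)) i j :
  `|M i j| <= `|M|.
Proof.
rewrite /Num.norm /= mx_normrE.
exact: (le_bigmax _ (fun ij : 'I_m * 'I_n => `|M ij.1 ij.2|) (i, j)).
Qed.

Lemma mx_norm_le (R : realType) m n (M : 'M[R]_(m, n)) (c : R) : 0 <= c ->
  (forall i j, `|M i j| <= c) -> `|M| <= c.
Proof.
move=> c0 Mc; rewrite /Num.norm /= mx_normrE.
by apply: bigmax_le => // -[i j] _; exact: Mc.
Qed.

(** Causality: the past of a time within the horizon lies within the horizon. *)
Lemma subset_horizon (R : realType) (tf t : R) :
  t \in `[0, tf] -> `[0, t]%classic `<=` `[0, tf]%classic.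
Proof.
rewrite in_itv /= => /andP[_ ttf] s /=.
by rewrite !in_itv /= => /andP[-> /= st]; exact: le_trans st ttf.
Qed.

Lemma reversed_in_horizon (R : realType) (tf t : R) :
  t \in `[0, tf] -> tf - t \in `[0, tf].
Proof. by rewrite !in_itv /= => /andP[? ?]; apply/andP; split; lra. Qed.

(** * Convolution with a kernel of finite gain *)

Definition continuous_kernel (R : realType) p m (K : R -> 'M[R]_(p, m)) : Prop :=
  forall i j, continuous (fun s => K s i j).

(** Bound on the L1 norm of each row of the kernel, hence on the operator norm of
    the convolution for bounded signals. *)
Definition has_gain (R : realType) p m (K : R -> 'M[R]_(p, m)) (g : R) : Prop :=
  forall i, (\sum_j \int[lebesgue_measure]_(s in `[0%R, +oo[) `|K s i j|%:E
             <= g%:E)%E.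

(** [io_map A B C] is, by definition, the convolution with
    [fun s => C *m expmx (s *: A) *m B]. *)
Definition convolution (R : realType) p m (K : R -> 'M[R]_(p, m))
    (u : signal R m) : signal R p :=
  fun t => \col_i \int[lebesgue_measure]_(tau in `[0, t])
    (K (t - tau) *m u tau) i 0.

(** The substitution [s |-> t - s], decreasing with derivative -1, maps the
    interval onto itself. *)
Lemma reflection_integral (R : realType) (f : R -> R) (t : R) : 0 <= t ->
  continuous f ->
  (\int[lebesgue_measure]_(s in `[0%R, t]) (f s)%:E
   = \int[lebesgue_measure]_(s in `[0%R, t]) (f (t - s))%:E)%E.
Proof.
move=> t0 cf; pose F s := t - s.
have dF s : (F^`()%classic) s = -1.
  by rewrite derive1E /F deriveB// derive_cst derive_id sub0r.
have dFE : F^`()%classic = cst (-1) by apply/funext.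
have cF : continuous F by move=> s; apply: cvgB; [exact: cvg_cst|exact: cvg_id].
have := @integration_by_substitution_decreasing R F f 0 t t0.
have F0 : F 0 = t by rewrite /F subr0.
have Ft : F t = 0 by rewrite /F subrr.
rewrite F0 Ft dFE => -> //.
- by apply: eq_integral => s _; rewrite /= opprK mulr1.
- by move=> x y _ _ xy; rewrite /F ltrD2l ltrN2.
- by move=> s _; exact: cvg_cst.
- exact: is_cvg_cst.
- exact: is_cvg_cst.
- split.
  + by move=> s _; exact: derivableB.
  + exact/cvg_at_right_filter/cF.
  + exact/cvg_at_left_filter/cF.
- exact: continuous_subspaceT.
Qed.

Lemma reflected_kernel_continuous (R : realType) p m (K : R -> 'M[R]_(p, m)) t i j :
  continuous_kernel K -> continuous (fun s => K (t - s) i j).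
Proof.
move=> cK s; apply: (@continuous_comp _ _ _ (fun s => t - s) (fun s => K s i j)).
  by apply: cvgB; [exact: cvg_cst|exact: cvg_id].
exact: cK.
Qed.

(** Reflection turns the truncated integral of the kernel seen backwards from [t]
    into a truncated integral from 0, which the integral over the half-line
    dominates: this is why the gain does not depend on the horizon. *)
Lemma reflected_gain (R : realType) p m (K : R -> 'M[R]_(p, m)) (g t : R) i :
  continuous_kernel K -> has_gain K g -> 0 <= t ->
  (\sum_j \int[lebesgue_measure]_(tau in `[0%R, t]) `|K (t - tau) i j|%:E
   <= g%:E)%E.
Proof.
move=> cK gK t0; apply: le_trans (gK i); apply: lee_sum => j _.
have cf : continuous (fun s => `|K s i j|).
  by move=> s; apply: cvg_norm; exact: cK.
rewrite -(@reflection_integral R (fun s => `|K s i j|))//.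
apply: ge0_subset_integral => //.
- apply/measurable_EFinP; apply: measurable_funTS; exact: continuous_measurable_fun.
- by move=> s; rewrite /= !in_itv /= => /andP[->].
Qed.

Lemma measurable_convolution_integrand (R : realType) p m (K : R -> 'M[R]_(p, m))
    (t : R) (D : set R) (u : signal R m) i :
  continuous_kernel K ->
  (forall j, measurable_fun D (fun tau => u tau j 0)) ->
  measurable_fun D (fun tau => (K (t - tau) *m u tau) i 0).
Proof.
move=> cK mu.
have -> : (fun tau => (K (t - tau) *m u tau) i 0) =
    (fun tau => \sum_j K (t - tau) i j * u tau j 0).
  by apply/funext => tau; rewrite mxE.
apply: measurable_sum => j; apply: measurable_funM => //.
apply: measurable_funTS; apply: continuous_measurable_fun.
exact: reflected_kernel_continuous.
Qed.

(** The pointwise bound [sum_j |K_ij| |u_j| <= M sum_j |K_ij|] holds almost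
    everywhere, and the L1 norm of the row is at most [g].  Integrability, the
    norm bound and the Fubini argument below all rest on this estimate. *)
Lemma convolution_abs_integral_le (R : realType) p m (K : R -> 'M[R]_(p, m))
    (g t M : R) (u : signal R m) i :
  continuous_kernel K -> has_gain K g -> 0 <= t -> 0 <= M ->
  (forall j, measurable_fun `[0, t] (fun tau => u tau j 0)) ->
  {ae lebesgue_measure, forall tau, tau \in `[0, t] -> `|u tau| <= M} ->
  (\int[lebesgue_measure]_(tau in `[0%R, t]) `|(K (t - tau) *m u tau) i 0|%:E
   <= (g * M)%:E)%E.
Proof.
move=> cK gK t0 M0 mu uM.
have mK j : measurable_fun `[0, t] (fun tau => K (t - tau) i j).
  apply: measurable_funTS; apply: continuous_measurable_fun.
  exact: reflected_kernel_continuous.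
have mKabs j : measurable_fun `[0, t] (fun tau => `|K (t - tau) i j|).
  by apply: measurableT_comp => //; exact: mK.
have mKu := measurable_convolution_integrand t i cK mu.
apply: (@le_trans _ _ (\int[lebesgue_measure]_(tau in `[0%R, t])
    (\sum_j M%:E * `|K (t - tau) i j|%:E))%E).
  apply: ae_ge0_le_integral => //.
  - by apply/measurable_EFinP; exact: measurableT_comp.
  - move=> tau _; apply: sume_ge0 => j _.
    by rewrite -EFinM lee_fin mulr_ge0.
  - apply: emeasurable_sum => j; apply/measurable_EFinP.
    by apply: measurable_funM; [exact: measurable_cst|exact: mKabs].
  - apply: ae_imp uM => tau uM t0t; have {}uM := uM t0t.
    under eq_bigr do rewrite -EFinM; rewrite sumEFin lee_fin mxE.
    apply: le_trans (ler_norm_sum _ _ _) _; apply: ler_sum => j _.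
    rewrite normrM mulrC. rewrite ler_wpM2r//.
    exact: le_trans (ler_mx_norm_entry _ _ _) uM.
rewrite ge0_integral_sum//; last 2 first.
- move=> j; apply/measurable_EFinP.
  by apply: measurable_funM; [exact: measurable_cst|exact: mKabs].
- by move=> j tau _; rewrite -EFinM lee_fin mulr_ge0.
under eq_bigr.
  move=> j _; rewrite ge0_integralZl//; last first.
    by apply/measurable_EFinP; exact: mKabs.
  over.
rewrite -ge0_sume_distrr//; last first.
  by move=> j _; apply: integral_ge0 => tau _; rewrite lee_fin.
by rewrite muleC EFinM lee_wpmul2r ?lee_fin//; exact: reflected_gain.
Qed.

Lemma integrable_convolution_integrand (R : realType) p m (K : R -> 'M[R]_(p, m))
    (g t M : R) (u : signal R m) i :
  continuous_kernel K -> has_gain K g -> 0 <= t -> 0 <= M ->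
  (forall j, measurable_fun `[0, t] (fun tau => u tau j 0)) ->
  {ae lebesgue_measure, forall tau, tau \in `[0, t] -> `|u tau| <= M} ->
  lebesgue_measure.-integrable `[0, t]
    (EFin \o (fun tau => (K (t - tau) *m u tau) i 0)).
Proof.
move=> cK gK t0 M0 mu uM; apply/integrableP; split.
  by apply/measurable_EFinP; exact: measurable_convolution_integrand.
apply: le_lt_trans (convolution_abs_integral_le i cK gK t0 M0 mu uM) _.
exact: ltry.
Qed.

Lemma convolution_norm_le (R : realType) p m (K : R -> 'M[R]_(p, m))
    (g t M : R) (u : signal R m) :
  continuous_kernel K -> has_gain K g -> 0 <= g -> 0 <= t -> 0 <= M ->
  (forall j, measurable_fun `[0, t] (fun tau => u tau j 0)) ->
  {ae lebesgue_measure, forall tau, tau \in `[0, t] -> `|u tau| <= M} ->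
  `|convolution K u t| <= g * M.
Proof.
move=> cK gK g0 t0 M0 mu uM; apply: mx_norm_le; first exact: mulr_ge0.
move=> i j; rewrite mxE.
have iu := integrable_convolution_integrand i cK gK t0 M0 mu uM.
apply: le_trans (le_normr_Rintegral _ iu) _ => //.
have := convolution_abs_integral_le i cK gK t0 M0 mu uM.
rewrite -lee_fin; apply: le_trans.
rewrite /Rintegral fineK//.
apply: integrable_fin_num => //=.
exact: (integrable_norm iu).
Qed.

Lemma convolutionD (R : realType) p m (K : R -> 'M[R]_(p, m))
    (g t Mu Mv : R) (u v : signal R m) :
  continuous_kernel K -> has_gain K g -> 0 <= t -> 0 <= Mu -> 0 <= Mv ->
  (forall j, measurable_fun `[0, t] (fun tau => u tau j 0)) ->
  {ae lebesgue_measure, forall tau, tau \in `[0, t] -> `|u tau| <= Mu} ->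
  (forall j, measurable_fun `[0, t] (fun tau => v tau j 0)) ->
  {ae lebesgue_measure, forall tau, tau \in `[0, t] -> `|v tau| <= Mv} ->
  convolution K (u \+ v) t = convolution K u t + convolution K v t.
Proof.
move=> cK gK t0 Mu0 Mv0 mu uM mv vM; apply/colP => i; rewrite !mxE.
rewrite -RintegralD//.
- by apply: eq_Rintegral => tau _; rewrite mulmxDr mxE.
- exact: (integrable_convolution_integrand i cK gK t0 Mu0 mu uM).
- exact: (integrable_convolution_integrand i cK gK t0 Mv0 mv vM).
Qed.

(** * Joint measurability of processes *)

(** Tonelli's theorem applied to the positive and negative parts.  Where an
    integral is infinite or undefined, the real-valued integral takes a default
    value, and taking the finite part is itself a measurable operation. *)
Lemma measurable_Rintegral_section d1 d2 (T1 : measurableType d1)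
    (T2 : measurableType d2) (R : realType)
    (m2 : {sigma_finite_measure set T2 -> \bar R}) (f : T1 * T2 -> R) :
  measurable_fun [set: T1 * T2] f ->
  measurable_fun [set: T1] (fun x => \int[m2]_y f (x, y)).
Proof.
move=> mf.
have mEf : measurable_fun [set: T1 * T2] (EFin \o f) by exact/measurable_EFinP.
rewrite /Rintegral; apply: (measurableT_comp (fine_measurable measurableT)).
have -> : (fun x => \int[m2]_y (f (x, y))%:E)%E =
    ((fun x => \int[m2]_y ((EFin \o f)^\+ (x, y))) \-
     (fun x => \int[m2]_y ((EFin \o f)^\- (x, y))))%E.
  apply/funext => x; rewrite [LHS]integralE.
  by congr (_ + - _)%E; apply: eq_integral => y _; rewrite ?funeposE ?funenegE.
apply: emeasurable_funB.
- apply: measurable_fun_fubini_tonelli_F; last by move=> x; exact: funepos_ge0.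
  exact: measurable_funepos.
- apply: measurable_fun_fubini_tonelli_F; last by move=> x; exact: funeneg_ge0.
  exact: measurable_funeneg.
Qed.

(** The triangle of pairs (present time, past time) over which the convolution
    integrates. *)
Lemma measurable_past (R : realType) d (Omega : measurableType d) (tf : R) :
  measurable [set q : (R * Omega) * R | [/\ 0 <= q.2, q.2 <= q.1.1 & q.1.1 <= tf]].
Proof.
have m1 : measurable_fun [set: (R * Omega) * R] (fun q => q.1.1).
  exact: (measurableT_comp measurable_fst measurable_fst).
have m2 : measurable_fun [set: (R * Omega) * R] snd by exact: measurable_snd.
have A1 := measurable_fun_le measurableT (@measurable_cst _ _ _ _ setT (0 : R)) m2.
have A2 := measurable_fun_le measurableT m2 m1.
have A3 := measurable_fun_le measurableT m1 (@measurable_cst _ _ _ _ setT tf).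
have := measurableI _ _ A1 (measurableI _ _ A2 A3).
congr (measurable _); apply/seteqP; split=> q /=; rewrite ?setTI.
- by case=> [[_ ?] [[_ ?] [_ ?]]].
- by case.
Qed.

(** The value at [(t, w)] is the integral, over a third variable, of a function of
    [((t, w), tau)] cut off outside the triangle [0 <= tau <= t <= tf]; that
    function is measurable, and so are its integrals over sections.  Outcomes with
    an unbounded path are thereby covered. *)
Lemma jointly_measurable_convolution (R : realType) p m (K : R -> 'M[R]_(p, m))
    d (Omega : measurableType d) (tf : R) (X : process R m Omega) :
  continuous_kernel K -> jointly_measurable tf X ->
  jointly_measurable tf (fun t w => convolution K (sample_path X w) t).
Proof.
move=> cK mX i.
set D := [set q : (R * Omega) * R | [/\ 0 <= q.2, q.2 <= q.1.1 & q.1.1 <= tf]].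
have mD : measurable D by exact: measurable_past.
pose h (q : (R * Omega) * R) := (K (q.1.1 - q.2) *m X q.2 q.1.2) i 0.
have mh : measurable_fun D h.
  have -> : h = (fun q => \sum_j K (q.1.1 - q.2) i j * X q.2 q.1.2 j 0).
    by apply/funext => q; rewrite /h mxE.
  apply: measurable_sum => j; apply: measurable_funM.
    apply: measurable_funTS.
    apply: (@measurableT_comp _ _ _ _ _ _ (fun s => K s i j)).
      by apply: continuous_measurable_fun; exact: cK.
    apply: measurable_funB; last exact: measurable_snd.
    exact: (measurableT_comp measurable_fst measurable_fst).
  apply: (@measurable_comp _ _ _ _ _ _ (`[0, tf] `*` [set: Omega])
    (fun r : R * Omega => X r.1 r.2 j 0) _ (fun q => (q.2, q.1.2))) => //.
  - exact: measurableX.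
  - move=> _ [q [q0 q1 q2] <-]; split => //=.
    by rewrite in_itv /= q0 (le_trans q1 q2).
  - apply: measurable_funTS; apply: measurable_fun_pair; first exact: measurable_snd.
    exact: (measurableT_comp measurable_snd measurable_fst).
have := measurable_Rintegral_section lebesgue_measure
  ((measurable_restrictT h mD).1 mh).
move=> /(@measurable_funTS _ _ _ _ (`[0, tf] `*` [set: Omega])).
apply: eq_measurable_fun => -[t w] /set_mem [/= t0tf _].
rewrite mxE Rintegral_mkcond; apply: eq_Rintegral => tau _.
rewrite /patch; case: ifPn => tauD; case: ifPn => // tauI.
- exfalso; move: tauI; rewrite notin_setE; apply.
  by move: tauD => /set_mem [/= a b c]; rewrite in_itv /= a b.
- exfalso; move: tauD; rewrite notin_setE; apply.
  move: tauI t0tf => /set_mem /=; rewrite !in_itv /= => /andP[a b] /andP[_ c].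
  by split.
Qed.

Lemma jointly_measurable_mxact (R : realType) p m d (Omega : measurableType d)
    (tf : R) (M : 'M[R]_(p, m)) (X : process R m Omega) :
  jointly_measurable tf X -> jointly_measurable tf (fun t w => M *m X t w).
Proof.
move=> mX i.
have -> : (fun r : R * Omega => (M *m X r.1 r.2) i 0) =
    (fun r => \sum_j M i j * X r.1 r.2 j 0).
  by apply/funext => r; rewrite mxE.
by apply: measurable_sum => j; apply: measurable_funM => //; exact: mX.
Qed.

Lemma jointly_measurableD (R : realType) m d (Omega : measurableType d)
    (tf : R) (X Y : process R m Omega) :
  jointly_measurable tf X -> jointly_measurable tf Y ->
  jointly_measurable tf (fun t w => X t w + Y t w).
Proof.
move=> mX mY i.
have -> : (fun r : R * Omega => (X r.1 r.2 + Y r.1 r.2) i 0) =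
    (fun r => X r.1 r.2 i 0 + Y r.1 r.2 i 0).
  by apply/funext => r; rewrite mxE.
by apply: measurable_funD.
Qed.

Lemma jointly_measurableZ (R : realType) m d (Omega : measurableType d)
    (tf a : R) (X : process R m Omega) :
  jointly_measurable tf X -> jointly_measurable tf (fun t w => a *: X t w).
Proof.
move=> mX i.
have -> : (fun r : R * Omega => (a *: X r.1 r.2) i 0) =
    (fun r => a * X r.1 r.2 i 0).
  by apply/funext => r; rewrite mxE.
by apply: measurable_funM.
Qed.

Lemma jointly_measurable_time_reversal (R : realType) m d (Omega : measurableType d)
    (tf : R) (X : process R m Omega) :
  jointly_measurable tf X -> jointly_measurable tf (fun t w => X (tf - t) w).
Proof.
move=> mX i.
apply: (@measurable_comp _ _ _ _ _ _ (`[0, tf] `*` [set: Omega])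
    (fun r : R * Omega => X r.1 r.2 i 0) _
    (fun r : R * Omega => (tf - r.1, r.2))) => //.
- exact: measurableX.
- by move=> _ [[t w] [/= t0tf _] <-]; split => //=; exact: reversed_in_horizon.
- apply: measurable_funTS; apply: measurable_fun_pair; last exact: measurable_snd.
  by apply: measurable_funB => //; exact: measurable_fst.
Qed.

Lemma jointly_measurable_signal (R : realType) m d (Omega : measurableType d)
    (tf : R) (u : signal R m) :
  (forall i, measurable_fun `[0, tf] (fun t => u t i 0)) ->
  jointly_measurable tf (fun t (_ : Omega) => u t).
Proof.
move=> mu i.
apply: (@measurable_comp _ _ _ _ _ _ `[0, tf]%classic (fun t => u t i 0) _ fst) => //.
- by move=> _ [[t w] [/= t0tf _] <-].
- by apply: measurable_funTS; exact: measurable_fst.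
Qed.

(** Sections of jointly measurable functions are measurable for every outcome,
    not merely for almost every one. *)
Lemma measurable_sample_path (R : realType) m d (Omega : measurableType d)
    (tf : R) (X : process R m Omega) w i :
  jointly_measurable tf X ->
  measurable_fun `[0, tf] (fun t => sample_path X w t i 0).
Proof.
move=> mX.
apply: (@measurable_comp _ _ _ _ _ _ (`[0, tf] `*` [set: Omega])
    (fun r : R * Omega => X r.1 r.2 i 0) _ (fun t => (t, w))) => //.
- exact: measurableX.
- by move=> _ [t /= t0tf <-].
- by apply: measurable_funTS; exact: pair2_measurable.
Qed.

Lemma measurable_at_time (R : realType) m d (Omega : measurableType d)
    (tf t : R) (X : process R m Omega) i :
  jointly_measurable tf X -> t \in `[0, tf] ->
  measurable_fun [set: Omega] (fun w => X t w i 0).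
Proof.
move=> mX t0tf.
apply: (@measurable_comp _ _ _ _ _ _ (`[0, tf] `*` [set: Omega])
    (fun r : R * Omega => X r.1 r.2 i 0) _ (fun w => (t, w))) => //.
- exact: measurableX.
- by move=> _ [w _ <-].
- exact: pair1_measurable.
Qed.

(** * Bounded centred noise under linear operations *)

Lemma expectation_integralE (R : realType) d (Omega : measurableType d)
    (P : probability Omega R) (X : Omega -> R) :
  ('E_P[X] = \int[P]_w (X w)%:E)%E.
Proof. by rewrite unlock. Qed.

Lemma mean_zero_mulmx (R : realType) p m d (Omega : measurableType d)
    (P : probability Omega R) (M : 'M[R]_(p, m)) (X : Omega -> 'cV[R]_m) :
  mean_zero P X -> mean_zero P (fun w => M *m X w).
Proof.
move=> hX i; rewrite expectation_integralE.
have E w : ((M *m X w) i 0)%:E = (\sum_j (M i j)%:E * (X w j 0)%:E)%E.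
  by rewrite mxE -sumEFin; apply: eq_bigr => j _; rewrite EFinM.
have iX j : P.-integrable [set: Omega] (fun w => (M i j)%:E * (X w j 0)%:E)%E.
  by apply: integrableZl => //; exact: (hX j).1.
split.
  have := integrable_sum measurableT (index_enum 'I_m) (fun j (_ : true) => iX j).
  by apply: eq_integrable => // w _; rewrite -E.
under eq_integral do rewrite E.
rewrite integral_sum// big1// => j _; rewrite integralZl//; last exact: (hX j).1.
by have [_] := hX j; rewrite expectation_integralE => ->; rewrite mule0.
Qed.

Lemma mean_zeroD (R : realType) m d (Omega : measurableType d)
    (P : probability Omega R) (X Y : Omega -> 'cV[R]_m) :
  mean_zero P X -> mean_zero P Y -> mean_zero P (fun w => X w + Y w).
Proof.
move=> hX hY i; rewrite expectation_integralE.
have E w : ((X w + Y w) i 0)%:E = ((X w i 0)%:E + (Y w i 0)%:E)%E.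
  by rewrite mxE EFinD.
have [[iX eX] [iY eY]] := (hX i, hY i).
split.
  have := integrableD measurableT iX iY.
  by apply: eq_integrable => // w _; rewrite -E.
under eq_integral do rewrite E.
rewrite integralD//; move: eX eY; rewrite !expectation_integralE => -> ->.
by rewrite adde0.
Qed.

Lemma admissible_noise_mxact (R : realType) p m d (Omega : measurableType d)
    (P : probability Omega R) (tf b c : R) (M : 'M[R]_(p, m))
    (X : process R m Omega) :
  (forall v : 'cV[R]_m, `|M *m v| <= c * `|v|) -> 0 <= c ->
  admissible_noise P tf b X ->
  admissible_noise P tf (c * b) (fun t w => M *m X t w).
Proof.
move=> Mc c0 [mX zX bX]; split.
- exact: jointly_measurable_mxact.
- by move=> t t0tf; apply: mean_zero_mulmx; exact: zX.
- apply: ae_imp bX => w bX t t0tf; apply: le_trans (Mc _) _.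
  by rewrite ler_wpM2l// bX.
Qed.

Lemma admissible_noiseD (R : realType) m d (Omega : measurableType d)
    (P : probability Omega R) (tf b c : R) (X Y : process R m Omega) :
  admissible_noise P tf b X -> admissible_noise P tf c Y ->
  admissible_noise P tf (b + c) (fun t w => X t w + Y t w).
Proof.
move=> [mX zX bX] [mY zY bY]; split.
- exact: jointly_measurableD.
- by move=> t t0tf; apply: mean_zeroD; [exact: zX|exact: zY].
- apply: ae_imp (ae_and bX bY) => w [{}bX {}bY] t t0tf.
  by apply: le_trans (ler_normD _ _) _; rewrite lerD ?bX ?bY.
Qed.

Lemma admissible_noise_time_reversal (R : realType) m d (Omega : measurableType d)
    (P : probability Omega R) (tf b : R) (X : process R m Omega) :
  admissible_noise P tf b X ->
  admissible_noise P tf b (fun t w => X (tf - t) w).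
Proof.
move=> [mX zX bX]; split.
- exact: jointly_measurable_time_reversal.
- by move=> t t0tf; apply: zX; exact: reversed_in_horizon.
- by apply: ae_imp bX => w bX t t0tf; apply: bX; exact: reversed_in_horizon.
Qed.

(** The null set on which the estimates may fail is that of the bound on [X], so a
    single one serves all times [t]. *)
Lemma convolution_path_le (R : realType) p m (K : R -> 'M[R]_(p, m)) d
    (Omega : measurableType d) (P : probability Omega R) (tf g b : R)
    (X : process R m Omega) :
  continuous_kernel K -> has_gain K g -> 0 <= g -> 0 <= b ->
  admissible_noise P tf b X ->
  {ae P, forall w, forall t, t \in `[0, tf] ->
    [/\ `|convolution K (sample_path X w) t| <= g * b,
    forall i, lebesgue_measure.-integrable `[0, t]
      (EFin \o (fun tau => (K (t - tau) *m X tau w) i 0))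
    & forall i, (\int[lebesgue_measure]_(tau in `[0%R, t])
        `|(K (t - tau) *m X tau w) i 0|%:E <= (g * b)%:E)%E]}.
Proof.
move=> cK gK g0 b0 [mX zX bX]; apply: ae_imp bX => w bX t t0tf.
have t0 : 0 <= t by move: t0tf; rewrite in_itv => /andP[].
have sub := subset_horizon t0tf.
have mw j : measurable_fun `[0, t] (fun tau => sample_path X w tau j 0).
  by apply: measurable_funS sub _ => //; exact: measurable_sample_path.
have bw : {ae lebesgue_measure, forall tau, tau \in `[0, t] ->
    `|sample_path X w tau| <= b}.
  by apply: aeW => tau tau0t; apply: bX; exact: sub.
split.
- exact: convolution_norm_le.
- by move=> i; exact: (integrable_convolution_integrand i cK gK t0 b0 mw bw).
- by move=> i; exact: (convolution_abs_integral_le i cK gK t0 b0 mw bw).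
Qed.

(** Fubini's theorem exchanges the expectation with the integral over past times;
    the inner expectation is a fixed linear combination of the centred entries
    of [X tau].  Integrability on the product space comes from
    [convolution_abs_integral_le], which bounds the inner integral over time by
    [g * b] for almost every outcome. *)
Lemma mean_zero_convolution (R : realType) p m (K : R -> 'M[R]_(p, m)) d
    (Omega : measurableType d) (P : probability Omega R) (tf g b t : R)
    (X : process R m Omega) :
  continuous_kernel K -> has_gain K g -> 0 <= g -> 0 <= b ->
  admissible_noise P tf b X -> t \in `[0, tf] ->
  mean_zero P (fun w => convolution K (sample_path X w) t).
Proof.
move=> cK gK g0 b0 aX t0tf i; rewrite expectation_integralE.
have paths := convolution_path_le cK gK g0 b0 aX.
have [mX zX bX] := aX.
have sub := subset_horizon t0tf.
have mG := jointly_measurable_convolution cK mX.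
have mGt : measurable_fun [set: Omega]
    (fun w => convolution K (sample_path X w) t i 0).
  exact: measurable_at_time mG t0tf.
have iG : P.-integrable [set: Omega]
    (EFin \o (fun w => convolution K (sample_path X w) t i 0)).
  apply/integrableP; split; first exact/measurable_EFinP.
  apply: (@le_lt_trans _ _ (\int[P]_w (cst (g * b)%:E) w)%E); last first.
    rewrite integral_cst// [X in (_ * X)%E](_ : _ = 1%E).
      by rewrite mule1 ltry.
    exact: probability_setT.
  apply: ae_ge0_le_integral => //.
  - by apply: measurableT_comp => //; exact/measurable_EFinP.
  - by move=> w _; rewrite lee_fin mulr_ge0.
  - apply: ae_imp paths => w /(_ t t0tf) [h _ _] _; rewrite /= lee_fin.
    exact: le_trans (ler_mx_norm_entry _ _ _) h.
split => //.
(* The integrand as a function of past time and outcome; [f] below is its cut-off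
   outside the past of [t], to which Fubini's theorem applies. *)
pose h (r : R * Omega) := (K (t - r.1) *m X r.1 r.2) i 0.
pose D : set (R * Omega) := `[0, t] `*` [set: Omega].
have mD : measurable D by exact: measurableX.
have mh : measurable_fun D h.
  have -> : h = (fun r => \sum_j K (t - r.1) i j * X r.1 r.2 j 0).
    by apply/funext => r; rewrite /h mxE.
  apply: measurable_sum => j; apply: measurable_funM.
    apply: measurable_funTS.
    have mK : measurable_fun [set: R] (fun s => K (t - s) i j).
      by apply: continuous_measurable_fun; exact: reflected_kernel_continuous.
    exact: (measurableT_comp mK measurable_fst).
  apply: measurable_funS (mX j); first exact: measurableX.
  by move=> [s w] [/= s0t _]; split => //=; exact: sub.
pose f (r : R * Omega) := ((h \_ D) r)%:E.
have mf : measurable_fun [set: R * Omega] f.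
  by apply/measurable_EFinP; exact: (measurable_restrictT h mD).1.
have hD s w : (h \_ D) (s, w) = ((fun s => h (s, w)) \_ `[0, t]) s.
  rewrite /patch; congr (if _ then _ else _).
  by apply/idP/idP; rewrite !inE; [case|].
have intf w : (\int[lebesgue_measure]_s f (s, w))%E =
    (\int[lebesgue_measure]_(s in `[0%R, t]) (h (s, w))%:E)%E.
  rewrite [RHS]integral_mkcond; apply: eq_integral => s _.
  by rewrite /f hD /patch; case: ifP.
have intabsf w : (\int[lebesgue_measure]_s `|f (s, w)|)%E =
    (\int[lebesgue_measure]_(s in `[0%R, t]) `|h (s, w)|%:E)%E.
  rewrite [RHS]integral_mkcond; apply: eq_integral => s _.
  by rewrite /f hD /patch; case: ifP => //; rewrite /= normr0.
have If : (lebesgue_measure \x P)%E.-integrable [set: R * Omega] f.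
  apply/(integrable21ltyP lebesgue_measure P mf).
  apply: (@le_lt_trans _ _ (\int[P]_w (cst (g * b)%:E) w)%E); last first.
    rewrite integral_cst// [X in (_ * X)%E](_ : _ = 1%E).
      by rewrite mule1 ltry.
    exact: probability_setT.
  apply: ae_ge0_le_integral => //.
  - by move=> w _; exact: integral_ge0.
  - have mabsf : measurable_fun [set: R * Omega] (abse \o f).
      exact: measurableT_comp.
    exact: (@measurable_fun_fubini_tonelli_G _ _ _ _ R lebesgue_measure
      (abse \o f) mabsf (fun=> abse_ge0 _)).
  - by move=> w _; rewrite lee_fin mulr_ge0.
  - by apply: ae_imp paths => w /(_ t t0tf) [_ _ hi] _; rewrite intabsf; exact: hi.
(* The real-valued path integral agrees with the extended one only where the
   latter is finite, which holds almost surely. *)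
transitivity (\int[P]_w \int[lebesgue_measure]_s f (s, w))%E.
  apply: ae_eq_integral => //.
  - exact/measurable_EFinP.
  - exact: (measurable_fubini_G If).
  - apply: ae_imp paths => w /(_ t t0tf) [_ hi _] _.
    rewrite intf mxE /Rintegral fineK//.
    by apply: integrable_fin_num => //; exact: hi.
rewrite -(Fubini If); apply: integral0_eq => s _.
have [s0t|s0t] := boolP (s \in `[0, t]); last first.
  apply: integral0_eq => w _; rewrite /f hD /patch ifF//.
  by apply/negP => /set_mem; exact/negP.
rewrite (eq_integral (fun w => ((K (t - s) *m X s w) i 0)%:E)); last first.
  by move=> w _; rewrite /f hD /patch ifT//; exact/mem_set.
have [] := mean_zero_mulmx (K (t - s)) (zX s (sub s s0t)) i.
by rewrite expectation_integralE.
Qed.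

Lemma admissible_noise_convolution (R : realType) p m (K : R -> 'M[R]_(p, m)) d
    (Omega : measurableType d) (P : probability Omega R) (tf g b : R)
    (X : process R m Omega) :
  continuous_kernel K -> has_gain K g -> 0 <= g -> 0 <= b ->
  admissible_noise P tf b X ->
  admissible_noise P tf (g * b) (fun t w => convolution K (sample_path X w) t).
Proof.
move=> cK gK g0 b0 aX; split.
- by have [mX _ _] := aX; exact: jointly_measurable_convolution.
- by move=> t t0tf; exact: mean_zero_convolution aX t0tf.
- by apply: ae_imp (convolution_path_le cK gK g0 b0 aX) => w h t /h [].
Qed.

(** * Bounded signals and the impulse response *)

Definition impulse_response (R : realType) n m (A : 'M[R]_n) (B : 'M[R]_(n, m))
    (C : 'M[R]_(m, n)) (s : R) : 'M[R]_m :=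
  C *m expmx (s *: A) *m B.

(** A bound at every time, rather than almost every time, is what convolution
    produces; it passes through time reversal without any appeal to the
    invariance of null sets. *)
Definition bounded_signal (R : realType) m (tf : R) (u : signal R m) : Prop :=
  (forall i, measurable_fun `[0, tf] (fun t => u t i 0)) /\
  exists2 M : R, 0 <= M & forall t, t \in `[0, tf] -> `|u t| <= M.

Lemma continuous_kernel_mulmx (R : realType) p q r s (M : 'M[R]_(p, q))
    (K : R -> 'M[R]_(q, r)) (N : 'M[R]_(r, s)) :
  continuous_kernel K -> continuous_kernel (fun t => M *m K t *m N).
Proof.
move=> cK i j.
have -> : (fun t => (M *m K t *m N) i j) =
    (fun t => \sum_k (\sum_l M i l * K t l k) * N k j).
  by apply/funext => t; rewrite mxE; apply: eq_bigr => k _; rewrite mxE.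
have cl k l : continuous (fun t => M i l * K t l k).
  by move=> t; apply: cvgM; [exact: cvg_cst|exact: cK].
have ck k : continuous (fun t => \sum_l M i l * K t l k).
  by apply: continuous_big => [|l _]; [exact: add_continuous|exact: cl].
apply: continuous_big => [|k _]; first exact: add_continuous.
by move=> t; apply: cvgM; [exact: ck|exact: cvg_cst].
Qed.

Lemma continuous_impulse_response (R : realType) n m (A : 'M[R]_n)
    (B : 'M[R]_(n, m)) (C : 'M[R]_(m, n)) :
  continuous_kernel (impulse_response A B C).
Proof. by apply: continuous_kernel_mulmx => i j; exact: continuous_expmx. Qed.

Lemma continuous_bounded_on (R : realType) (f : R -> R) (tf : R) : 0 <= tf ->
  continuous f -> exists2 M, 0 <= M & forall t, t \in `[0, tf] -> `|f t| <= M.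
Proof.
move=> tf0 cf.
have [|c ctf fc] := @EVT_max R (fun t => `|f t|) 0 tf tf0.
  by apply: continuous_subspaceT => t; apply: cvg_norm; exact: cf.
by exists `|f c|.
Qed.

Lemma bounded_free_response (R : realType) n m (A : 'M[R]_n)
    (C : 'M[R]_(m, n)) (x0 : 'cV[R]_n) (tf : R) : 0 <= tf ->
  bounded_signal tf (free_response A C x0).
Proof.
move=> tf0.
have c i : continuous (fun t => free_response A C x0 t i 0).
  by apply: continuous_kernel_mulmx => k l; exact: continuous_expmx.
split.
  by move=> i; apply: measurable_funTS; exact: continuous_measurable_fun.
have /choice[M MP] i : exists M, 0 <= M /\
    forall t, t \in `[0, tf] -> `|free_response A C x0 t i 0| <= M.
  by have [M M0 MP] := continuous_bounded_on tf0 (c i); exists M.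
exists (\sum_i M i); first by apply: sumr_ge0 => i _; have [] := MP i.
move=> t t0tf; apply: mx_norm_le; first by apply: sumr_ge0 => i _; have [] := MP i.
move=> i j; rewrite ord1; apply: le_trans ((MP i).2 t t0tf) _.
by rewrite (bigD1 i)//= lerDl; apply: sumr_ge0 => k _; have [] := MP k.
Qed.

Lemma bounded_signal_Linfty (R : realType) m (tf : R) (u : signal R m) :
  bounded_signal tf u -> is_Linfty tf u.
Proof. by move=> [mu [M _ uM]]; split => //; exists M; apply: aeW. Qed.

(** The definition lets the essential bound be any real number; estimates need it
    nonnegative. *)
Lemma Linfty_bound (R : realType) m (tf : R) (u : signal R m) :
  is_Linfty tf u -> exists2 M : R, 0 <= M &
    {ae lebesgue_measure, forall t, t \in `[0, tf] -> `|u t| <= M}.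
Proof.
move=> [_ [M uM]]; exists (Num.max 0 M); first by rewrite le_max lexx.
by apply: ae_imp uM => t uM /uM; rewrite le_max => ->; rewrite orbT.
Qed.

Lemma LinftyD (R : realType) m (tf : R) (u v : signal R m) :
  is_Linfty tf u -> is_Linfty tf v -> is_Linfty tf (u \+ v).
Proof.
move=> [mu [M uM]] [mv [N vN]]; split.
  move=> i; have -> : (fun t => (u \+ v) t i 0) = (fun t => u t i 0 + v t i 0).
    by apply/funext => t; rewrite mxE.
  exact: measurable_funD.
exists (M + N); apply: ae_imp (ae_and uM vN) => t [{}uM {}vN] t0tf.
by apply: le_trans (ler_normD _ _) _; rewrite lerD ?uM ?vN.
Qed.

Lemma LinftyZ (R : realType) m (tf a : R) (u : signal R m) :
  is_Linfty tf u -> is_Linfty tf (fun t => a *: u t).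
Proof.
move=> [mu [M uM]]; split.
  move=> i; have -> : (fun t => (a *: u t) i 0) = (fun t => a * u t i 0).
    by apply/funext => t; rewrite mxE.
  exact: measurable_funM.
exists (`|a| * M); apply: ae_imp uM => t uM t0tf.
by rewrite normrZ ler_wpM2l// uM.
Qed.

Lemma bounded_signalD (R : realType) m (tf : R) (u v : signal R m) :
  bounded_signal tf u -> bounded_signal tf v -> bounded_signal tf (u \+ v).
Proof.
move=> [mu [M M0 uM]] [mv [N N0 vN]]; split.
  move=> i; have -> : (fun t => (u \+ v) t i 0) = (fun t => u t i 0 + v t i 0).
    by apply/funext => t; rewrite mxE.
  exact: measurable_funD.
exists (M + N); first exact: addr_ge0.
by move=> t t0tf; apply: le_trans (ler_normD _ _) _; rewrite lerD ?uM ?vN.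
Qed.

Lemma bounded_signal_time_reversal (R : realType) m (tf : R) (u : signal R m) :
  bounded_signal tf u -> bounded_signal tf (time_reversal tf u).
Proof.
move=> [mu [M M0 uM]]; split.
  move=> i.
  have mX := jointly_measurable_time_reversal
    (@jointly_measurable_signal R m _ R tf u mu).
  exact (measurable_sample_path (0 : R) i mX).
by exists M => // t t0tf; apply: uM; exact: reversed_in_horizon.
Qed.

(** * Row-sum norms *)

Lemma norm_oo_ge0 (R : realType) m n (M : 'M[\bar R]_(m, n)) : (0 <= norm_oo M)%E.
Proof. exact: bigmax_ge_id. Qed.

Lemma row_le_norm_oo (R : realType) m n (M : 'M[\bar R]_(m, n)) i :
  (\sum_j `|M i j| <= norm_oo M)%E.
Proof. exact: (le_bigmax _ (fun i => (\sum_j `|M i j|)%E)). Qed.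

Lemma norm_oo_EFin (R : realType) m n (M : 'M[R]_(m, n)) :
  norm_oo (map_mx EFin M) = (fine (norm_oo (map_mx EFin M)))%:E.
Proof.
rewrite fineK// ge0_fin_numE ?norm_oo_ge0//; apply: bigmax_lt => // i _.
by under eq_bigr do rewrite mxE abse_EFin; rewrite sumEFin ltry.
Qed.

(** The maximum absolute row sum is the operator norm for the maximum norm. *)
Lemma norm_mulmx_le (R : realType) m n (M : 'M[R]_(m, n)) (v : 'cV[R]_n) :
  `|M *m v| <= fine (norm_oo (map_mx EFin M)) * `|v|.
Proof.
apply: mx_norm_le => [|i j]; first by rewrite mulr_ge0// fine_ge0 ?norm_oo_ge0.
rewrite mxE; apply: le_trans (ler_norm_sum _ _ _) _.
apply: (@le_trans _ _ (\sum_k `|M i k| * `|v|)).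
  by apply: ler_sum => k _; rewrite normrM ler_wpM2l// ler_mx_norm_entry.
rewrite -mulr_suml ler_wpM2r// -lee_fin -norm_oo_EFin -sumEFin.
apply: le_trans (row_le_norm_oo _ i).
by apply: lee_sum => k _; rewrite mxE.
Qed.

Lemma norm_signature_le (R : realType) m (S : 'M[R]_m) (v : 'cV[R]_m) :
  is_signature S -> `|S *m v| <= `|v|.
Proof.
move=> [/is_diag_mxP Sd Spm]; apply: mx_norm_le => // i j.
rewrite mxE (bigD1 i)//= big1 ?addr0; last first.
  by move=> k ki; rewrite Sd ?mul0r// eq_sym.
apply: le_trans (ler_mx_norm_entry v i j).
by case: (Spm i) => ->; rewrite ?mul1r ?mulN1r ?normrN.
Qed.

(** * Superposition for the noisy iteration *)

Lemma bounded_signal_mxact (R : realType) p m (M : 'M[R]_(p, m)) (tf : R)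
    (u : signal R m) :
  bounded_signal tf u -> bounded_signal tf (mxact M u).
Proof.
move=> [mu [N N0 uN]]; split.
  move=> i; have -> : (fun t => mxact M u t i 0) =
      (fun t => \sum_j M i j * u t j 0).
    by apply/funext => t; rewrite mxE.
  by apply: measurable_sum => j; apply: measurable_funM.
exists (fine (norm_oo (map_mx EFin M)) * N).
  by rewrite mulr_ge0// fine_ge0 ?norm_oo_ge0.
move=> t t0tf; apply: le_trans (norm_mulmx_le _ _) _.
by rewrite ler_wpM2l ?uN// fine_ge0 ?norm_oo_ge0.
Qed.

(** Measurability of a deterministic convolution is the case of a process that
    does not depend on the outcome, here over the real line as sample space. *)
Lemma bounded_signal_convolution (R : realType) p m (K : R -> 'M[R]_(p, m))
    (tf g : R) (u : signal R m) :
  continuous_kernel K -> has_gain K g -> 0 <= g ->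
  is_Linfty tf u -> bounded_signal tf (convolution K u).
Proof.
move=> cK gK g0 uL; have [M M0 uM] := Linfty_bound uL; split.
  move=> i; have mX := jointly_measurable_convolution cK
    (@jointly_measurable_signal R m _ R tf u uL.1).
  exact (measurable_sample_path (0 : R) i mX).
exists (g * M); first exact: mulr_ge0.
move=> t t0tf; have sub := subset_horizon t0tf.
have t0 : 0 <= t by move: t0tf; rewrite in_itv => /andP[].
apply: convolution_norm_le => //.
  by move=> j; apply: measurable_funS sub _ => //; exact: uL.1.
by apply: ae_imp uM => s uM s0t; apply: uM; exact: sub.
Qed.

Lemma Linfty_convolutionD (R : realType) p m (K : R -> 'M[R]_(p, m))
    (tf g t : R) (u v : signal R m) :
  continuous_kernel K -> has_gain K g ->
  is_Linfty tf u -> is_Linfty tf v -> t \in `[0, tf] ->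
  convolution K (u \+ v) t = convolution K u t + convolution K v t.
Proof.
move=> cK gK uL vL t0tf; have sub := subset_horizon t0tf.
have t0 : 0 <= t by move: t0tf; rewrite in_itv => /andP[].
have [M M0 uM] := Linfty_bound uL; have [N N0 vN] := Linfty_bound vL.
apply: (convolutionD cK gK t0 M0 N0).
- by move=> j; apply: measurable_funS sub _ => //; exact: uL.1.
- by apply: ae_imp uM => s uM s0t; apply: uM; exact: sub.
- by move=> j; apply: measurable_funS sub _ => //; exact: vL.1.
- by apply: ae_imp vN => s vN s0t; apply: vN; exact: sub.
Qed.

(** The iterates are controlled only on the horizon, while signals are functions
    on the whole line. *)
Lemma eq_convolution (R : realType) p m (K : R -> 'M[R]_(p, m)) (tf t : R)
    (u v : signal R m) :
  (forall s, s \in `[0, tf] -> u s = v s) -> t \in `[0, tf] ->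
  convolution K u t = convolution K v t.
Proof.
move=> uv t0tf; apply/colP => i; rewrite !mxE; apply: eq_Rintegral.
move=> s /set_mem s0t.
by rewrite uv//; exact: subset_horizon t0tf s s0t.
Qed.

Lemma noisy_TopE (R : realType) (n m : nat) (A : 'M[R]_n) (B : 'M[R]_(n, m))
    (C : 'M[R]_(m, n)) (Se Q W : 'M[R]_m) (x0 : 'cV[R]_n) (tf : R)
    (e1 e2 u : signal R m) t :
  let K := impulse_response A B C in
  noisy_Top A B C Se Q W x0 tf e1 e2 u t =
  (- invmx W *m Se) *m
    (convolution K (fun s => (Se *m Q) *m
       (convolution K u (tf - s) + free_response A C x0 (tf - s) + e1 (tf - s)))
      (tf - t) + e2 (tf - t)).
Proof. by []. Qed.

Lemma TopE (R : realType) (n m : nat) (A : 'M[R]_n) (B : 'M[R]_(n, m))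
    (C : 'M[R]_(m, n)) (Se Q W : 'M[R]_m) (x0 : 'cV[R]_n) (tf : R)
    (u : signal R m) t :
  let K := impulse_response A B C in
  Top A B C Se Q W x0 tf u t =
  (- invmx W *m Se) *m
    (convolution K (fun s => (Se *m Q) *m
       (convolution K u (tf - s) + free_response A C x0 (tf - s)))
      (tf - t)).
Proof. by []. Qed.

Lemma bounded_Top (R : realType) (n m : nat) (A : 'M[R]_n) (B : 'M[R]_(n, m))
    (C : 'M[R]_(m, n)) (Se Q W : 'M[R]_m) (x0 : 'cV[R]_n) (tf g : R)
    (u : signal R m) : 0 <= tf -> 0 <= g ->
  has_gain (impulse_response A B C) g ->
  is_Linfty tf u -> bounded_signal tf (Top A B C Se Q W x0 tf u).
Proof.
move=> tf0 g0 gK uL; have cK := @continuous_impulse_response R n m A B C.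
apply: bounded_signal_mxact; apply: bounded_signal_time_reversal.
apply: (bounded_signal_convolution cK gK g0); apply: bounded_signal_Linfty.
apply: bounded_signal_mxact; apply: bounded_signal_time_reversal.
apply: bounded_signalD; last exact: bounded_free_response.
exact: (bounded_signal_convolution cK gK g0).
Qed.

Lemma bounded_noisy_Top (R : realType) (n m : nat) (A : 'M[R]_n)
    (B : 'M[R]_(n, m)) (C : 'M[R]_(m, n)) (Se Q W : 'M[R]_m) (x0 : 'cV[R]_n)
    (tf g : R) (e1 e2 u : signal R m) : 0 <= tf -> 0 <= g ->
  has_gain (impulse_response A B C) g ->
  bounded_signal tf e1 -> bounded_signal tf e2 -> is_Linfty tf u ->
  bounded_signal tf (noisy_Top A B C Se Q W x0 tf e1 e2 u).
Proof.
move=> tf0 g0 gK be1 be2 uL; have cK := @continuous_impulse_response R n m A B C.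
apply: bounded_signal_mxact; apply: bounded_signal_time_reversal.
apply: bounded_signalD => //.
apply: (bounded_signal_convolution cK gK g0); apply: bounded_signal_Linfty.
apply: bounded_signal_mxact; apply: bounded_signal_time_reversal.
apply: bounded_signalD => //.
apply: bounded_signalD; last exact: bounded_free_response.
exact: (bounded_signal_convolution cK gK g0).
Qed.

Lemma Linfty_nominal_iter (R : realType) (n m : nat) (A : 'M[R]_n)
    (B : 'M[R]_(n, m)) (C : 'M[R]_(m, n)) (Se Q W : 'M[R]_m) (x0 : 'cV[R]_n)
    (tf g alpha : R) (u0 : signal R m) k : 0 <= tf -> 0 <= g ->
  has_gain (impulse_response A B C) g -> is_Linfty tf u0 ->
  is_Linfty tf (nominal_iter A B C Se Q W x0 tf alpha u0 k).
Proof.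
move=> tf0 g0 gK uL; elim: k => [//|k IH] /=.
apply: LinftyD; apply: LinftyZ => //.
by apply: bounded_signal_Linfty; exact: bounded_Top gK IH.
Qed.

Lemma Linfty_noisy_iter (R : realType) (n m : nat) (A : 'M[R]_n)
    (B : 'M[R]_(n, m)) (C : 'M[R]_(m, n)) (Se Q W : 'M[R]_m) (x0 : 'cV[R]_n)
    (tf g alpha : R) (u0 : signal R m) (e1 e2 : nat -> signal R m) k :
  0 <= tf -> 0 <= g ->
  has_gain (impulse_response A B C) g -> is_Linfty tf u0 ->
  (forall l, bounded_signal tf (e1 l)) -> (forall l, bounded_signal tf (e2 l)) ->
  is_Linfty tf (noisy_iter A B C Se Q W x0 tf alpha u0 e1 e2 k).
Proof.
move=> tf0 g0 gK uL be1 be2; elim: k => [//|k IH] /=.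
apply: LinftyD; apply: LinftyZ => //.
by apply: bounded_signal_Linfty; exact: bounded_noisy_Top gK _ _ IH.
Qed.

(** Additivity of the two nested convolutions; the free response and the nominal
    input go to the first summand, the noise to the second.  The bounds make all
    the integrals finite, without which the integral is not additive. *)
Lemma noisy_Top_superposition (R : realType) (n m : nat) (A : 'M[R]_n)
    (B : 'M[R]_(n, m)) (C : 'M[R]_(m, n)) (Se Q W : 'M[R]_m) (x0 : 'cV[R]_n)
    (tf g : R) (e1 e2 u v w : signal R m) t : 0 <= tf -> 0 <= g ->
  has_gain (impulse_response A B C) g ->
  bounded_signal tf e1 -> is_Linfty tf u -> is_Linfty tf v ->
  (forall s, s \in `[0, tf] -> w s = u s + v s) -> t \in `[0, tf] ->
  noisy_Top A B C Se Q W x0 tf e1 e2 w t =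
  Top A B C Se Q W x0 tf u t + noisy_Top A B C Se Q W 0 tf e1 e2 v t.
Proof.
move=> tf0 g0 gK be1 uL vL wuv t0tf.
have cK := @continuous_impulse_response R n m A B C.
rewrite !noisy_TopE TopE -mulmxDr addrA; congr (_ *m (_ + _)).
have bG x (y : signal R m) : is_Linfty tf y -> bounded_signal tf
    (convolution (impulse_response A B C) y \+ free_response A C x).
  move=> yL; apply: bounded_signalD; last exact: bounded_free_response.
  exact: (bounded_signal_convolution cK gK g0).
have L1 : is_Linfty tf (fun s => (Se *m Q) *m
    (convolution (impulse_response A B C) u (tf - s)
     + free_response A C x0 (tf - s))).
  apply: bounded_signal_Linfty.
  exact (bounded_signal_mxact (Se *m Q) (bounded_signal_time_reversal (bG x0 u uL))).
have L2 : is_Linfty tf (fun s => (Se *m Q) *m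
    (convolution (impulse_response A B C) v (tf - s)
     + free_response A C 0 (tf - s)
     + e1 (tf - s))).
  apply: bounded_signal_Linfty.
  exact (bounded_signal_mxact (Se *m Q)
    (bounded_signal_time_reversal (bounded_signalD (bG 0 v vL) be1))).
rewrite -(Linfty_convolutionD cK gK L1 L2); last exact: reversed_in_horizon.
apply: (@eq_convolution _ _ _ _ tf); last exact: reversed_in_horizon.
move=> s s0tf; rewrite /= -mulmxDr; congr (_ *m _).
have s'0tf := reversed_in_horizon s0tf.
rewrite (eq_convolution _ wuv s'0tf) (Linfty_convolutionD cK gK uL vL s'0tf).
rewrite /free_response mulmx0 addr0.
by rewrite -!addrA; congr (_ + _); rewrite addrCA.
Qed.

(** The second summand starts from zero and is excited by the noise alone: it is
    the deviation from the nominal iterate. *)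
Lemma noisy_iter_superposition (R : realType) (n m : nat) (A : 'M[R]_n)
    (B : 'M[R]_(n, m)) (C : 'M[R]_(m, n)) (Se Q W : 'M[R]_m) (x0 : 'cV[R]_n)
    (tf g alpha : R) (u0 : signal R m) (e1 e2 : nat -> signal R m) k t :
  0 <= tf -> 0 <= g ->
  has_gain (impulse_response A B C) g -> is_Linfty tf u0 ->
  (forall l, bounded_signal tf (e1 l)) -> (forall l, bounded_signal tf (e2 l)) ->
  t \in `[0, tf] ->
  noisy_iter A B C Se Q W x0 tf alpha u0 e1 e2 k t =
  nominal_iter A B C Se Q W x0 tf alpha u0 k t
  + noisy_iter A B C Se Q W 0 tf alpha (fun=> 0) e1 e2 k t.
Proof.
move=> tf0 g0 gK uL be1 be2.
elim: k t => [|k IH] t t0tf /=; first by rewrite addr0.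
have zL : is_Linfty tf (fun=> 0 : 'cV[R]_m).
  apply: bounded_signal_Linfty; split; last by exists 0 => // s _; rewrite normr0.
  by move=> i; exact: measurable_cst.
rewrite (noisy_Top_superposition Se Q W x0 _ tf0 g0 gK (be1 k)
  (Linfty_nominal_iter Se Q W x0 alpha k tf0 g0 gK uL)
  (Linfty_noisy_iter Se Q W 0 alpha k tf0 g0 gK zL be1 be2) IH t0tf).
by rewrite IH// !scalerDr addrACA.
Qed.

(** * The deviation is bounded centred noise *)

Lemma admissible_noise_le (R : realType) m d (Omega : measurableType d)
    (P : probability Omega R) (tf b c : R) (X : process R m Omega) :
  b <= c -> admissible_noise P tf b X -> admissible_noise P tf c X.
Proof.
move=> bc [mX zX bX]; split => //.
by apply: ae_imp bX => w bX t t0tf; apply: le_trans (bX t t0tf) bc.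
Qed.

Lemma admissible_noiseZ (R : realType) m d (Omega : measurableType d)
    (P : probability Omega R) (tf a b : R) (X : process R m Omega) :
  admissible_noise P tf b X ->
  admissible_noise P tf (`|a| * b) (fun t w => a *: X t w).
Proof.
have -> : (fun t w => a *: X t w) = (fun t w => a%:M *m X t w).
  by apply/funext => t; apply/funext => w; rewrite mul_scalar_mx.
by apply: admissible_noise_mxact => // v; rewrite mul_scalar_mx normrZ.
Qed.

Lemma admissible_noise0 (R : realType) m d (Omega : measurableType d)
    (P : probability Omega R) (tf b : R) : 0 <= b ->
  admissible_noise P tf b (fun _ _ => 0 : 'cV[R]_m).
Proof.
move=> b0; split.
- by move=> i; exact: measurable_cst.
- move=> t t0tf i; split.
    have := integrable0 P [set: Omega].
    by apply: eq_integrable => // w _ /=; rewrite mxE.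
  rewrite expectation_integralE; apply: integral0_eq => w _.
  by rewrite mxE.
- by apply: aeW => w t _; rewrite normr0.
Qed.

(** The mean sees only almost-sure values, but measurability of [Y] is a separate
    hypothesis since the probability space is not assumed complete. *)
Lemma mean_zero_ae_eq (R : realType) m d (Omega : measurableType d)
    (P : probability Omega R) (X Y : Omega -> 'cV[R]_m) :
  (forall i, measurable_fun [set: Omega] (fun w => Y w i 0)) ->
  {ae P, forall w, X w = Y w} -> mean_zero P X -> mean_zero P Y.
Proof.
move=> mY XY zX i; have [iX eX] := zX i.
have mYi : measurable_fun [set: Omega] (fun w => (Y w i 0)%:E).
  exact/measurable_EFinP.
have mXi := measurable_int _ iX.
split.
  move/integrableP : iX => [_ iX]; apply/integrableP; split => //.
  rewrite (ae_eq_integral (fun w => `|(X w i 0)%:E|)%E)//.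
  - exact: measurableT_comp.
  - exact: measurableT_comp.
  - by apply: ae_imp XY => w ->.
rewrite expectation_integralE -eX expectation_integralE.
by apply: ae_eq_integral => //; apply: ae_imp XY => w ->.
Qed.

Lemma jointly_measurable_noisy_iter (R : realType) (n m : nat) (A : 'M[R]_n)
    (B : 'M[R]_(n, m)) (C : 'M[R]_(m, n)) (Se Q W : 'M[R]_m) (x0 : 'cV[R]_n)
    d (Omega : measurableType d) (tf alpha : R) (u0 : signal R m)
    (eta1 eta2 : nat -> process R m Omega) k : 0 <= tf ->
  (forall i, measurable_fun `[0, tf] (fun t => u0 t i 0)) ->
  (forall l, jointly_measurable tf (eta1 l)) ->
  (forall l, jointly_measurable tf (eta2 l)) ->
  jointly_measurable tf (fun t w => noisy_iter A B C Se Q W x0 tf alpha u0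
    (fun l => sample_path (eta1 l) w) (fun l => sample_path (eta2 l) w) k t).
Proof.
move=> tf0 mu0 m1 m2; have cK := @continuous_impulse_response R n m A B C.
elim: k => [|k IH]; first exact: jointly_measurable_signal.
apply: jointly_measurableD; apply: jointly_measurableZ => //.
set X : process R m Omega := (X in jointly_measurable tf X) in IH.
have mGX := jointly_measurable_convolution cK IH.
have md : jointly_measurable tf (fun t (w : Omega) => free_response A C x0 t).
  exact: jointly_measurable_signal (bounded_free_response A C x0 tf0).1.
have m3 := jointly_measurableD (jointly_measurableD mGX md) (m1 k).
have m4 := jointly_measurable_mxact (Se *m Q) (jointly_measurable_time_reversal m3).
have m5 := jointly_measurableD (jointly_measurable_convolution cK m4) (m2 k).
exact (jointly_measurable_mxact (- invmx W *m Se)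
  (jointly_measurable_time_reversal m5)).
Qed.

(** The hypothesis on [b] says that one step of the recursion, with relaxation
    factor 1, maps deviations bounded by [b] to deviations bounded by [b]; convex
    combination preserves this. *)
Lemma admissible_noise_driven_iter (R : realType) (n m : nat) (A : 'M[R]_n)
    (B : 'M[R]_(n, m)) (C : 'M[R]_(m, n)) (Se Q W : 'M[R]_m)
    d (Omega : measurableType d) (P : probability Omega R) (tf alpha e g b : R)
    (eta1 eta2 : nat -> process R m Omega) k :
  let q := fine (norm_oo (map_mx EFin Q)) in
  let r := fine (norm_oo (map_mx EFin (invmx W))) in
  is_signature Se -> has_gain (impulse_response A B C) g -> 0 <= g ->
  0 <= alpha <= 1 -> 0 <= e -> 0 <= b ->
  r * (g * (q * (g * b + e)) + e) <= b ->
  (forall l, admissible_noise P tf e (eta1 l)) ->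
  (forall l, admissible_noise P tf e (eta2 l)) ->
  admissible_noise P tf b (fun t w => noisy_iter A B C Se Q W 0 tf alpha (fun=> 0)
    (fun l => sample_path (eta1 l) w) (fun l => sample_path (eta2 l) w) k t).
Proof.
move=> q r hS gK g0 /andP[a0 a1] e0 b0 hb h1 h2.
have cK := @continuous_impulse_response R n m A B C.
have q0 : 0 <= q by rewrite fine_ge0 ?norm_oo_ge0.
have r0 : 0 <= r by rewrite fine_ge0 ?norm_oo_ge0.
elim: k => [|k IH]; first exact: admissible_noise0.
apply: (@admissible_noise_le _ _ _ _ _ _ (`|1 - alpha| * b + `|alpha| * b)).
  by rewrite !ger0_norm ?subr_ge0// -mulrDl subrK mul1r.
apply: admissible_noiseD; apply: admissible_noiseZ => //.
apply: admissible_noise_le hb _.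
set X : process R m Omega := (X in admissible_noise P tf b X) in IH.
have aGX := admissible_noise_convolution cK gK g0 b0 IH.
have ad : admissible_noise P tf 0 (fun t (w : Omega) => free_response A C 0 t).
  rewrite (_ : (fun t (w : Omega) => _) = fun _ _ => 0); last first.
    by apply/funext => t; apply/funext => w; rewrite /free_response mulmx0.
  exact: admissible_noise0.
have a3 := admissible_noiseD (admissible_noiseD aGX ad) (h1 k).
rewrite addr0 in a3.
have SQ (v : 'cV[R]_m) : `|(Se *m Q) *m v| <= q * `|v|.
  rewrite -mulmxA; apply: le_trans (norm_signature_le _ hS) _.
  exact: norm_mulmx_le.
have WS (v : 'cV[R]_m) : `|(- invmx W *m Se) *m v| <= r * `|v|.
  rewrite mulNmx mulNmx normrN -mulmxA; apply: le_trans (norm_mulmx_le _ _) _.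
  by rewrite ler_wpM2l// norm_signature_le.
have a4 := admissible_noise_mxact SQ q0 (admissible_noise_time_reversal a3).
have c0 : 0 <= q * (g * b + e) by rewrite mulr_ge0// addr_ge0// mulr_ge0.
have a5 := admissible_noiseD (admissible_noise_convolution cK gK g0 c0 a4) (h2 k).
exact (admissible_noise_mxact WS r0 (admissible_noise_time_reversal a5)).
Qed.

Lemma admissible_paths_bounded (R : realType) m d (Omega : measurableType d)
    (P : probability Omega R) (tf e : R) (eta : nat -> process R m Omega) : 0 <= e ->
  (forall l, admissible_noise P tf e (eta l)) ->
  {ae P, forall w, forall l, bounded_signal tf (sample_path (eta l) w)}.
Proof.
move=> e0 h; apply: ae_foralln => l; have [mX _ bX] := h l.
apply: ae_imp bX => w bX; split; last by exists e.
by move=> i; exact: measurable_sample_path.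
Qed.

(** The deviation agrees with the noise-driven iterate for the outcomes with
    bounded noise paths, hence almost surely, and it is measurable everywhere
    by [jointly_measurable_noisy_iter]. *)
Lemma admissible_noise_deviation (R : realType) (n m : nat) (A : 'M[R]_n)
    (B : 'M[R]_(n, m)) (C : 'M[R]_(m, n)) (Se Q W : 'M[R]_m) (x0 : 'cV[R]_n)
    d (Omega : measurableType d) (P : probability Omega R) (tf alpha e g b : R)
    (u0 : signal R m) (eta1 eta2 : nat -> process R m Omega) k :
  let q := fine (norm_oo (map_mx EFin Q)) in
  let r := fine (norm_oo (map_mx EFin (invmx W))) in
  0 <= tf -> is_signature Se -> has_gain (impulse_response A B C) g -> 0 <= g ->
  0 <= alpha <= 1 -> 0 <= e -> 0 <= b ->
  r * (g * (q * (g * b + e)) + e) <= b ->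
  (forall l, admissible_noise P tf e (eta1 l)) ->
  (forall l, admissible_noise P tf e (eta2 l)) ->
  is_Linfty tf u0 ->
  admissible_noise P tf b (fun t w =>
    noisy_iter A B C Se Q W x0 tf alpha u0
      (fun l => sample_path (eta1 l) w) (fun l => sample_path (eta2 l) w) k t
    - nominal_iter A B C Se Q W x0 tf alpha u0 k t).
Proof.
move=> q r tf0 hS gK g0 ha e0 b0 hb h1 h2 uL.
have [_ zD bD] := admissible_noise_driven_iter k hS gK g0 ha e0 b0 hb h1 h2.
set nu := (X in admissible_noise _ _ _ X).
have mnu : jointly_measurable tf nu.
  have mnom := jointly_measurable_signal (Omega := Omega)
    (Linfty_nominal_iter Se Q W x0 alpha k tf0 g0 gK uL).1.
  have -> : nu = (fun t w => noisy_iter A B C Se Q W x0 tf alpha u0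
      (fun l => sample_path (eta1 l) w) (fun l => sample_path (eta2 l) w) k t
      + (-1) *: nominal_iter A B C Se Q W x0 tf alpha u0 k t).
    by apply/funext => t; apply/funext => w; rewrite scaleN1r.
  apply: jointly_measurableD; last exact: jointly_measurableZ.
  apply: jointly_measurable_noisy_iter => //; first exact: uL.1.
  - by move=> l; have [] := h1 l.
  - by move=> l; have [] := h2 l.
have nuD := ae_and (admissible_paths_bounded e0 h1) (admissible_paths_bounded e0 h2).
have nuE w (bw : (forall l, bounded_signal tf (sample_path (eta1 l) w)) /\
    (forall l, bounded_signal tf (sample_path (eta2 l) w))) t : t \in `[0, tf] ->
    nu t w = noisy_iter A B C Se Q W 0 tf alpha (fun=> 0)
      (fun l => sample_path (eta1 l) w) (fun l => sample_path (eta2 l) w) k t.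
  move=> t0tf; rewrite /nu.
  rewrite (noisy_iter_superposition Se Q W x0 alpha k tf0 g0 gK uL bw.1 bw.2 t0tf).
  by rewrite addrC addKr.
split => //.
- move=> t t0tf; apply: (mean_zero_ae_eq _ _ (zD t t0tf)).
    by move=> i; exact: measurable_at_time mnu t0tf.
  by apply: ae_imp nuD => w bw; rewrite nuE.
- apply: ae_imp (ae_and bD nuD) => w [{}bD bw] t t0tf.
  by rewrite nuE// bD.
Qed.

(** * Covariance and peak gain *)

Lemma has_gain_peak_gain (R : realType) (n m : nat)
    (A : 'M[R]_n) (B : 'M[R]_(n, m)) (C : 'M[R]_(m, n)) :
  (peak_gain A B C < +oo)%E ->
  has_gain (impulse_response A B C) (fine (peak_gain A B C)).
Proof.
move=> hpk i; rewrite fineK; last by rewrite ge0_fin_numE// norm_oo_ge0.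
apply: le_trans (row_le_norm_oo _ i); apply: lee_sum => j _.
by rewrite mxE; exact: lee_abs.
Qed.

(** For centred variables the covariance is the mean of a product, which an
    almost sure bound [b] keeps below [b ^ 2]. *)
Lemma norm_oo_Cov_le (R : realType) m d (Omega : measurableType d)
    (P : probability Omega R) (X : Omega -> 'cV[R]_m) (b : R) :
  mean_zero P X -> {ae P, forall w, `|X w| <= b} ->
  (norm_oo (Cov P X) <= (m%:R * b ^+ 2)%:E)%E.
Proof.
move=> zX bX.
have b2 : 0 <= b ^+ 2 by exact: sqr_ge0.
have mX i : measurable_fun [set: Omega] (fun w => X w i 0).
  by have /measurable_int/measurable_EFinP := (zX i).1.
have cov i j : (`|covariance P (fun w => X w i ord0) (fun w => X w j ord0)|
    <= (b ^+ 2)%:E)%E.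
  rewrite unlock (zX i).2 (zX j).2 expectation_integralE.
  have mXX : measurable_fun [set: Omega]
      (fun w => ((X w i 0 - 0) * (X w j 0 - 0))%:E).
    by apply/measurable_EFinP; apply: measurable_funM; apply: measurable_funB.
  apply: le_trans (le_abse_integral _ _ _) _ => //.
  apply: (@le_trans _ _ (\int[P]_w (cst (b ^+ 2)%:E) w)%E).
    apply: ae_ge0_le_integral => //.
    - exact: measurableT_comp.
    - apply: ae_imp bX => w bXw _.
      (* With zero means, centring subtracts 0. *)
      change (`|(X w i ord0 - 0) * (X w j ord0 - 0)|%:E <= (b ^+ 2)%:E)%E.
      rewrite lee_fin !subr0 normrM expr2.
      by apply: ler_pM => //; apply: le_trans (ler_mx_norm_entry _ _ _) bXw.
  rewrite integral_cst// [X in (_ * X)%E](_ : _ = 1%E).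
    by rewrite mule1.
  exact: probability_setT.
apply: bigmax_le; first by rewrite lee_fin mulr_ge0.
move=> i _; apply: (@le_trans _ _ (\sum_(j < m) (b ^+ 2)%:E)%E).
  by apply: lee_sum => j _; rewrite mxE.
by rewrite sumEFin sumr_const card_ord mulr_natl.
Qed.

Theorem theorem5 (R : realType) (n m : nat)
    (A : 'M[R]_n) (B : 'M[R]_(n, m)) (C : 'M[R]_(m, n)) (Se Q W : 'M[R]_m)
    (hsym : externally_symmetric A B C Se)
    (hQ : is_psd Q) (hW : is_pd W)
    (hstab : stabilizable A B)
    (hdet : detectable A (sqrtmx (C^T *m Q *m C)))
    (hpk : (peak_gain A B C < +oo)%E)
    (hgain : (norm_oo (map_mx EFin Q) * peak_gain A B C ^+ 2
              * norm_oo (map_mx EFin (invmx W)) < 1)%E)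
    (alpha : R) (halpha : 0 < alpha <= 1)
    (x0 : 'cV[R]_n) (e : R) (he : 0 < e)
    (d : R -> measure_display)
    (Omega : forall tf : R, measurableType (d tf))
    (P : forall tf : R, probability (Omega tf) R)
    (eta1 eta2 : forall tf : R, nat -> process R m (Omega tf))
    (hindep : forall tf : R, 0 < tf ->
       pairwise_independent (P tf) tf (fun i : nat + nat =>
         match i with inl k => eta1 tf k | inr k => eta2 tf k end))
    (heta1 : forall tf : R, 0 < tf ->
       forall k, admissible_noise (P tf) tf e (eta1 tf k))
    (heta2 : forall tf : R, 0 < tf ->
       forall k, admissible_noise (P tf) tf e (eta2 tf k))
    (u0 : R -> signal R m)
    (hu0 : forall tf : R, 0 < tf -> is_Linfty tf (u0 tf)) :
  let u tf k := nominal_iter A B C Se Q W x0 tf alpha (u0 tf) k in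
  let ut tf k (w : Omega tf) :=
    noisy_iter A B C Se Q W x0 tf alpha (u0 tf)
      (fun l => sample_path (eta1 tf l) w) (fun l => sample_path (eta2 tf l) w) k in
  let nu tf k : process R m (Omega tf) :=
    fun t w => ut tf k w t - u tf k t in
  (forall tf : R, 0 < tf -> forall k : nat,
     {ae lebesgue_measure, forall t : R, t \in `[0, tf] ->
       mean_zero (P tf) (nu tf k t)}) /\
  exists c : R, forall tf : R, 0 < tf -> forall k : nat,
    {ae lebesgue_measure, forall t : R, t \in `[0, tf] ->
      (norm_oo (Cov (P tf) (nu tf k t)) <= c%:E)%E}.
Proof.
move=> u ut nu.
have gK := has_gain_peak_gain hpk.
pose g := fine (peak_gain A B C).
pose q := fine (norm_oo (map_mx EFin Q)).
pose r := fine (norm_oo (map_mx EFin (invmx W))).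
have pkE : peak_gain A B C = g%:E by rewrite fineK// ge0_fin_numE ?norm_oo_ge0.
have g0 : 0 <= g by rewrite fine_ge0 ?norm_oo_ge0.
have q0 : 0 <= q by rewrite fine_ge0 ?norm_oo_ge0.
have r0 : 0 <= r by rewrite fine_ge0 ?norm_oo_ge0.
have rho1 : q * g ^+ 2 * r < 1.
  move: hgain; rewrite (norm_oo_EFin Q) (norm_oo_EFin (invmx W)) pkE.
  by rewrite -EFin_expe -!EFinM lte_fin.
(* The fixed point of one step of the recursion on bounds. *)
pose b := r * (g * q * e + e) / (1 - q * g ^+ 2 * r).
have rho' : 1 - q * g ^+ 2 * r != 0 by rewrite gt_eqF// subr_gt0.
have b0 : 0 <= b.
  rewrite divr_ge0// ?subr_ge0; last exact: ltW.
  by rewrite mulr_ge0// addr_ge0// ?mulr_ge0// ltW.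
have hb : r * (g * (q * (g * b + e)) + e) <= b.
  by rewrite [leLHS](_ : _ = b)// /b; field.
have alpha01 : 0 <= alpha <= 1 by case/andP: halpha => /ltW -> ->.
have anu tf (tf0 : 0 < tf) k : admissible_noise (P tf) tf b (nu tf k).
  exact: (admissible_noise_deviation x0 k (ltW tf0) hsym.1 gK g0 alpha01 (ltW he)
    b0 hb (heta1 tf tf0) (heta2 tf tf0) (hu0 tf tf0)).
split.
  move=> tf tf0 k; apply: aeW => t t0tf; have [_ znu _] := anu tf tf0 k.
  exact: znu.
exists (m%:R * b ^+ 2) => tf tf0 k; apply: aeW => t t0tf.
have [_ znu bnu] := anu tf tf0 k.
by apply: norm_oo_Cov_le (znu t t0tf) _; apply: ae_imp bnu => w; exact.
Qed.
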